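(* Let $P$ and $Q$ be finite, non-empty posets such that $P$ is connected. Assume $P^P\cong Q^Q$. Then $Q$ is connected, and therefore $P\cong Q$.
   Context: For a poset $P$, $P^P$ denotes the poset of order-preserving maps $P\to P$, ordered pointwise: $f\le g$ iff $f(p)\le g(p)$ for all $p\in P$. *)

(* Defs.v *)
From HB Require Import structures.
From mathcomp Require Import all_boot all_order.
Set Implicit Arguments. Unset Strict Implicit. Unset Printing Implicit Defensive.
Import Order.Theory.
Local Open Scope order_scope.

Definition monotone_fun (d : Order.disp_t) (T : finPOrderType d)
  (f : {ffun T -> T}) : bool :=
  [forall x, forall y, (x <= y) ==> (f x <= f y)].

Definition mono_maps (d : Order.disp_t) (T : finPOrderType d) : Type :=
  {f : {ffun T -> T} | monotone_fun f}.

Definition pw_le (d : Order.disp_t) (T : finPOrderType d)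
  (f g : mono_maps T) : Prop :=
  forall x : T, val f x <= val g x.

Definition selfmap_posets_iso (d1 d2 : Order.disp_t)
  (P : finPOrderType d1) (Q : finPOrderType d2) : Prop :=
  exists phi : mono_maps P -> mono_maps Q,
    bijective phi /\ forall f g, pw_le f g <-> pw_le (phi f) (phi g).

Definition poset_iso (d1 d2 : Order.disp_t)
  (P : finPOrderType d1) (Q : finPOrderType d2) : Prop :=
  exists h : P -> Q, bijective h /\ forall x y : P, x <= y <-> h x <= h y.

Definition connected_poset (d : Order.disp_t) (T : finPOrderType d) : Prop :=
  forall x y : T, connect (fun a b : T => a >=< b) x y.

(* Main.v *)
(* Let [M] be the poset of self-maps of [P].  The longest chains of [M] have
   length [height P * #|P|], and they start exactly at the maps that are
   constant on the components of [P] with values starting a longest chain of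
   [P] ("tall" elements).  Above such a map [f], the join-irreducible elements
   are the spikes (value [x] above [p], [f] elsewhere) with [x] join-irreducible
   above [f p].  Writing [J a] for the join-irreducibles above [a], every tall
   [a'] of [Q] thus gives a tall [a] of [P] with [P^d * J a] isomorphic to
   [Q^d * J a'].  Restricting to components, Hashimoto's refinement theorem for
   connected posets gives [P = C * D], [Qa' = C * E] and [Y = D^d * K], where
   [Qa'] is the component of [a'] and [Y] a component of [J a'].  If [a' = (c, e)]
   then [J a'] is the disjoint sum of [J c] and [J e], with [e] outside [J e], so
   [D] tends to be smaller than [E]: measuring heights shows that
   [#|Q| <= #|P|], and then measuring cardinals shows that [D] and [E] are
   trivial, so that [P] is the component [Qa'], which is all of [Q]. *)

Require Import Defs.
From mathcomp Require Import all_boot all_order.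
From mathcomp Require Import zify.
Set Implicit Arguments. Unset Strict Implicit. Unset Printing Implicit Defensive.

(** * Finite posets *)

(** A plain record, so that duals, products, subposets and the poset of self-maps are ordinary terms
    that can be formed and quantified over freely. *)
Record poset := Poset {
  carrier :> finType;
  ple : rel carrier;
  ple_refl : reflexive ple;
  ple_anti : antisymmetric ple;
  ple_trans : transitive ple }.

Notation "x [<=] y" := (ple x y) (at level 70, no associativity).
Definition plt (T : poset) (x y : T) := (x [<=] y) && (x != y).
Notation "x [<] y" := (plt x y) (at level 70, no associativity).
Definition pcmp (T : poset) (x y : T) := (x [<=] y) || (y [<=] x).

Lemma plt_le (T : poset) (x y : T) : x [<] y -> x [<=] y.
Proof. by case/andP. Qed.

Lemma plt_irr (T : poset) (x : T) : (x [<] x) = false.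
Proof. by rewrite /plt eqxx andbF. Qed.

Lemma ple_lt_trans (T : poset) (y x z : T) : x [<=] y -> y [<] z -> x [<] z.
Proof.
move=> xy /andP[yz ne]; rewrite /plt (ple_trans xy yz) /=.
apply: contra_neq ne => exz; apply: (@ple_anti T).
by rewrite yz -exz xy.
Qed.

Lemma plt_le_trans (T : poset) (y x z : T) : x [<] y -> y [<=] z -> x [<] z.
Proof.
move=> /andP[xy ne] yz; rewrite /plt (ple_trans xy yz) /=.
apply: contra_neq ne => exz; apply: (@ple_anti T).
by rewrite xy exz yz.
Qed.

Lemma plt_trans (T : poset) (y x z : T) : x [<] y -> y [<] z -> x [<] z.
Proof. by move=> /plt_le; apply: ple_lt_trans. Qed.

Lemma ple_eqVlt (T : poset) (x y : T) : (x [<=] y) = (x == y) || (x [<] y).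
Proof. by rewrite /plt; case: eqP => [->|] /=; rewrite ?ple_refl ?andbT. Qed.

Lemma ple_lt_false (T : poset) (x y : T) : x [<=] y -> y [<] x -> False.
Proof. by move=> xy /(ple_lt_trans xy); rewrite plt_irr. Qed.

(** * Duals, products and induced subposets *)

Section Constructions.
Variables T U : poset.

Definition dual_le : rel T := fun x y => y [<=] x.
Fact dual_refl : reflexive dual_le. Proof. exact: ple_refl. Qed.
Fact dual_anti : antisymmetric dual_le.
Proof. by move=> x y /andP[xy yx]; apply/(@ple_anti T)/andP. Qed.
Fact dual_trans : transitive dual_le.
Proof. by move=> y x z xy yz; apply: ple_trans yz xy. Qed.
Definition dual_poset := Poset dual_refl dual_anti dual_trans.

Definition prod_le : rel (T * U) :=
  fun z w => (z.1 [<=] w.1) && (z.2 [<=] w.2).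
Fact prod_refl : reflexive prod_le.
Proof. by move=> x; rewrite /prod_le !ple_refl. Qed.
Fact prod_anti : antisymmetric prod_le.
Proof.
move=> [x y] [x' y'] /andP[/andP[/= h1 h2] /andP[/= h3 h4]].
by congr pair; apply: ple_anti; rewrite ?h1 ?h2.
Qed.
Fact prod_trans : transitive prod_le.
Proof.
move=> y x z /andP[h1 h2] /andP[h3 h4].
by rewrite /prod_le (ple_trans h1 h3) (ple_trans h2 h4).
Qed.
Definition prod_poset := Poset prod_refl prod_anti prod_trans.

Variable S : pred T.
Definition sub_le : rel {x : T | S x} := fun x y => val x [<=] val y.
Fact sub_refl : reflexive sub_le. Proof. by move=> x; apply: ple_refl. Qed.
Fact sub_anti : antisymmetric sub_le.
Proof. by move=> x y h; apply/val_inj/ple_anti. Qed.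
Fact sub_trans : transitive sub_le.
Proof. by move=> y x z; apply: ple_trans. Qed.
Definition sub_poset := Poset sub_refl sub_anti sub_trans.
End Constructions.

Notation "T [*] U" := (prod_poset T U) (at level 40, left associativity).

Definition component (T : poset) (x : T) := sub_poset (connect (@pcmp T) x).
Definition connected (T : poset) := forall x y : T, connect (@pcmp T) x y.

Definition embedding (T U : poset) (h : T -> U) :=
  forall x y, (h x [<=] h y) = (x [<=] y).
Definition iso (T U : poset) := exists2 h : T -> U, bijective h & embedding h.

(** * Isomorphisms of posets *)

Section Iso.
Implicit Types T U V W : poset.

Lemma embedding_inj T U (h : T -> U) : embedding h -> injective h.
Proof.
by move=> e x y exy; apply: (@ple_anti T); rewrite -!e exy ple_refl.
Qed.

Lemma embedding_lt T U (h : T -> U) x y :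
  embedding h -> (h x [<] h y) = (x [<] y).
Proof. by move=> e; rewrite /plt e (inj_eq (embedding_inj e)). Qed.

Lemma iso_intro T U (h : T -> U) :
  embedding h -> (forall u, exists t, h t = u) -> iso T U.
Proof.
move=> e s; exists h => //; apply: inj_card_bij; first exact: embedding_inj.
rewrite -(card_image (embedding_inj e) T); apply/subset_leq_card/subsetP.
by move=> u _; have [t <-] := s u; apply: image_f.
Qed.

Lemma embedding_can T U (h : T -> U) g :
  embedding h -> cancel g h -> embedding g.
Proof. by move=> e c x y; rewrite -e !c. Qed.

Lemma iso_refl T : iso T T.
Proof. by exists id => //; exists id. Qed.

Lemma iso_sym T U : iso T U -> iso U T.
Proof.
case=> h [g hg gh] e; exists g; first by exists h.
exact: embedding_can gh.
Qed.

Lemma iso_trans U T V : iso T U -> iso U V -> iso T V.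
Proof.
case=> h bh eh [g bg eg]; exists (g \o h); first exact: bij_comp.
by move=> x y /=; rewrite eg eh.
Qed.

Lemma iso_card T U : iso T U -> #|T| = #|U|.
Proof. by case=> h bh _; apply: bij_eq_card bh. Qed.

Lemma iso_prod T U T' U' : iso T T' -> iso U U' -> iso (T [*] U) (T' [*] U').
Proof.
case=> h [h' hh' h'h] e [g [g' gg' g'g] e2].
apply: (@iso_intro (T [*] U) (T' [*] U') (fun z => (h z.1, g z.2))).
  by move=> x y /=; rewrite /prod_le /= e e2.
by move=> [u v]; exists (h' u, g' v); rewrite /= h'h g'g.
Qed.

Lemma iso_prodC T U : iso (T [*] U) (U [*] T).
Proof.
apply: (@iso_intro (T [*] U) (U [*] T) (fun z => (z.2, z.1))).
  by move=> x y /=; rewrite /prod_le /= andbC.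
by move=> [u v]; exists (v, u).
Qed.

Lemma iso_dual T U : iso T U -> iso (dual_poset T) (dual_poset U).
Proof. by case=> h bh e; exists h => // x y; apply: e. Qed.

Lemma iso_dualK T : iso (dual_poset (dual_poset T)) T.
Proof. by exists id => //; exists id. Qed.

Lemma iso_sub T U (h : T -> U) (S : pred T) (S' : pred U) :
    embedding h -> (forall x, S x -> S' (h x)) ->
    (forall u, S' u -> exists2 x, S x & h x = u) ->
  iso (sub_poset S) (sub_poset S').
Proof.
move=> e hS hS'.
pose f (x : sub_poset S) : sub_poset S' := exist _ (h (val x)) (hS _ (valP x)).
apply: (@iso_intro _ _ f) => [x y|[u Su]]; first exact: e.
have [x Sx hx] := hS' u Su; exists (exist _ x Sx).
by apply: val_inj.
Qed.

Lemma iso_sub_ext T (S S' : pred T) : S =1 S' -> iso (sub_poset S) (sub_poset S').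
Proof.
move=> e; apply: (@iso_sub _ _ id) => //= x; first by rewrite e.
by rewrite -e; exists x.
Qed.

Lemma iso_subT T (S : pred T) : (forall x, S x) -> iso (sub_poset S) T.
Proof.
move=> ST; apply: (@iso_intro _ _ (fun x : sub_poset S => val x)) => // x.
by exists (exist _ x (ST x)).
Qed.

Lemma card_prod_poset T U : #|T [*] U| = #|T| * #|U|.
Proof. exact: card_prod. Qed.
End Iso.

(** * Connectedness and components *)

Section Connect.
Implicit Types T U : poset.

Lemma pcmp_sym T : symmetric (@pcmp T).
Proof. by move=> x y; rewrite /pcmp orbC. Qed.

Lemma connect_pcmp_sym T : connect_sym (@pcmp T).
Proof. by apply/sym_connect_sym/pcmp_sym. Qed.

Lemma connect_ind (T : finType) (e : rel T) (R : T -> Prop) x y :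
  (forall a b, e a b -> R a -> R b) -> R x -> connect e x y -> R y.
Proof.
move=> step Rx /connectP[s]; elim: s x Rx => [|a s IH] x Rx /=; first by move=> _ ->.
by case/andP=> /step/(_ Rx)/IH; apply.
Qed.

Lemma connect_map T U (h : T -> U) x y :
  (forall a b, a [<=] b -> h a [<=] h b) ->
  connect (@pcmp T) x y -> connect (@pcmp U) (h x) (h y).
Proof.
move=> e; apply: (connect_ind (R := fun y => connect _ _ (h y)))
  => [a b ab|]; last exact: connect0.
move/connect_trans; apply; apply: connect1; move: ab; rewrite /pcmp.
by case/orP=> /e ->; rewrite ?orbT.
Qed.

Lemma connected_iso T U : iso T U -> connected T -> connected U.
Proof.
case=> h [g hg gh] e c x y; rewrite -(gh x) -(gh y).
by apply: connect_map (c _ _) => a b; rewrite e.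
Qed.

Lemma connected_prodr T U : T -> connected (T [*] U) -> connected U.
Proof.
move=> t c x y; apply: (connect_map (h := snd) (T := T [*] U) _ (c (t, x) (t, y))).
by move=> a b /andP[].
Qed.

Lemma connected_dual T : connected T -> connected (dual_poset T).
Proof.
move=> c x y; rewrite (eq_connect (e' := @pcmp T)); first exact: c.
by move=> a b; apply: orbC.
Qed.

(** For the backward direction, walk in the first coordinate with the second fixed, then in the
    second. *)
Lemma connect_prod T U (z w : T [*] U) :
  connect (@pcmp (T [*] U)) z w =
    connect (@pcmp T) z.1 w.1 && connect (@pcmp U) z.2 w.2.
Proof.
apply/idP/andP => [c|[]].
  by split; [apply: (connect_map (T := T [*] U) (h := fst)) c
    |apply: (connect_map (T := T [*] U) (h := snd)) c] => a b /andP[].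
case: z w => [x y] [x' y'] /= cx cy; apply: (@connect_trans _ _ (x', y)).
  by apply: (connect_map (U := T [*] U) (h := fun x => (x, y))) cx
    => a b ab; apply/andP; rewrite ple_refl.
by apply: (connect_map (U := T [*] U) (h := fun y => (x', y))) cy
  => a b ab; apply/andP; rewrite ple_refl.
Qed.

Lemma component_connected T (x : T) : connected (component x).
Proof.
have root (y : component x) : connect (@pcmp (component x)) (exist _ x (connect0 _ x)) y.
  case: y => y xy;
  (* Quantifying over the membership proof [h] lets the induction run along a path of [T] while the
     claim concerns the subposet. *)
  pose R y := forall h, connect (@pcmp (component x)) (exist _ x (connect0 _ x))
    (exist _ y h).
  have: R y; last exact.
  apply: (connect_ind (R := R)) xy => [a b ab Ra h|h]; last first.
    by rewrite (_ : exist _ _ _ = exist _ x (connect0 _ x)) ?connect0 //; apply: val_inj.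
  have ha : connect (@pcmp T) x a.
    by apply: connect_trans h _; rewrite connect_pcmp_sym connect1.
  by apply: connect_trans (Ra ha) _; apply: connect1.
by move=> y z; apply: connect_trans (root z); rewrite connect_pcmp_sym.
Qed.

Lemma component_iso T U (h : T -> U) x :
  bijective h -> embedding h -> iso (component x) (component (h x)).
Proof.
case=> g hg gh e; apply: (iso_sub e) => [y|u]; first by apply: connect_map => a b; rewrite e.
move=> c; exists (g u) => //; rewrite -(hg x).
by apply: connect_map c => a b; rewrite (embedding_can e gh).
Qed.

Lemma component_prod T U (x : T) (y : U) :
  iso (@component (T [*] U) (x, y)) (component x [*] component y).
Proof.
apply: iso_sym.
have hc (z : component x [*] component y) :
    connect (@pcmp (T [*] U)) (x, y) (val z.1, val z.2).
  by rewrite connect_prod (valP z.1) (valP z.2).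
pose h z : @component (T [*] U) (x, y) :=
  exist (connect (@pcmp (T [*] U)) (x, y)) _ (hc z).
apply: (@iso_intro _ _ h) => // -[[u v] c].
have [c1 c2] : connect (@pcmp T) x u /\ connect (@pcmp U) y v.
  by move: c; rewrite connect_prod => /andP.
by exists (exist _ u c1, exist _ v c2); apply: val_inj.
Qed.

Lemma component_dual T (x : T) :
  iso (@component (dual_poset T) x) (dual_poset (component x)).
Proof.
apply: (@iso_sub_ext (dual_poset T)) => y.
by apply: eq_connect => a b; apply: orbC.
Qed.

Lemma component_full T (x : T) : connected T -> iso (component x) T.
Proof. by move=> c; apply: iso_subT. Qed.
End Connect.

(** * Lengths of chains *)

Section Depth.
Variable T : poset.
Implicit Types x y z : T.

(** Length of a longest strictly ascending chain from [x], by recursion on a bound [k] for the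
    number of steps. *)
Fixpoint depth_rec k x :=
  if k is k'.+1 then \max_(y | x [<] y) (depth_rec k' y).+1 else 0.
Definition depth x := depth_rec #|T| x.
Definition height := \max_x depth x.
(* [x] is tall when a longest chain of [T] starts at [x]. *)
Definition tall x := depth x == height.

(** Strict up-sets shrink along [[<]], so any bound at least the size of the strict up-set of [x]
    gives the same value. *)
Lemma depth_rec_stable k k' x :
  #|[pred y | x [<] y]| <= k -> #|[pred y | x [<] y]| <= k' ->
  depth_rec k x = depth_rec k' x.
Proof.
have up0 z : #|[pred y | z [<] y]| <= 0 -> forall y, (z [<] y) = false.
  by rewrite leqn0 => /eqP/card0_eq/(_ _) h y; have := h y; rewrite inE.
elim: k k' x => [|k IH] [|k'] x //= hk hk'.
- by rewrite big_pred0 // => y; rewrite up0.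
- by rewrite big_pred0 // => y; rewrite up0.
apply: eq_bigr => y xy; congr _.+1.
have lt : #|[pred z | y [<] z]| < #|[pred z | x [<] z]|.
  apply/proper_card/properP; split.
    by apply/subsetP => z; rewrite !inE; apply: plt_trans.
  by exists y; rewrite !inE ?plt_irr.
by apply: IH; rewrite -ltnS; apply: leq_trans lt _.
Qed.

Lemma depthE x : depth x = \max_(y | x [<] y) (depth y).+1.
Proof.
rewrite {1}/depth (@depth_rec_stable _ #|T|.+1) ?max_card //.
by apply: leq_trans (max_card _) _.
Qed.

Lemma depth_lt x y : x [<] y -> depth y < depth x.
Proof. by move=> xy; rewrite [depth x]depthE (bigmax_sup y). Qed.

Lemma depth_le x y : x [<=] y -> depth y <= depth x.
Proof. by rewrite ple_eqVlt => /orP[/eqP->//|/depth_lt/ltnW]. Qed.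

Lemma depth_step x n : depth x = n.+1 -> exists2 y, x [<] y & depth y = n.
Proof.
case: (pickP [pred y | x [<] y]) => [y0 xy0|no]; last first.
  by rewrite depthE big_pred0.
by rewrite depthE (bigmax_eq_arg y0) //; case: arg_maxnP => // y xy _ [<-]; exists y.
Qed.

(** [depth] is the least function that decreases strictly along [[<]]; upper bounds on depths below
    come from exhibiting such a [g]. *)
Lemma depth_least (g : T -> nat) :
  (forall x y, x [<] y -> g y < g x) -> forall x, depth x <= g x.
Proof.
move=> gP x; move: {2}(depth x) (erefl (depth x)) => n.
elim: n x => [|n IH] x dx; first by rewrite dx.
have [y xy dy] := depth_step dx; rewrite dx -dy.
by apply: leq_ltn_trans (gP _ _ xy); apply: IH.
Qed.

Lemma depth_height x : depth x <= height.
Proof. exact: leq_bigmax. Qed.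

Lemma tall_exists : T -> exists x, tall x.
Proof.
move=> x0; have c : 0 < #|T| by apply/card_gt0P; exists x0.
by have [x hx] := eq_bigmax depth c; exists x; rewrite /tall /height hx.
Qed.

Lemma tall_minimal x y : tall x -> y [<=] x -> y = x.
Proof.
move=> /eqP tx; rewrite ple_eqVlt => /orP[/eqP//|/depth_lt].
by rewrite tx ltnNge depth_height.
Qed.

Lemma height_le n : (forall x, depth x <= n) -> height <= n.
Proof. by move=> h; apply/bigmax_leqP => x _; apply: h. Qed.

Lemma height0_card : connected T -> height = 0 -> #|T| <= 1.
Proof.
move=> c h0; apply/card_le1_eqP => x y _ _.
have nolt (a b : T) : a [<] b -> False.
  by move=> /depth_lt; have := depth_height a; rewrite h0; lia.
symmetry; apply: (connect_ind (R := eq x) _ _ (c x y)) => // a b ab ->.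
by case/orP: ab; rewrite ple_eqVlt => /orP[/eqP//|/nolt].
Qed.

Lemma height_gt0_step x : tall x -> 0 < height -> exists y, x [<] y.
Proof.
move=> /eqP; case: height => // n dx _.
by have [y xy _] := depth_step dx; exists y.
Qed.

End Depth.

(** * Depth and height under maps, products, up-sets and duality *)

Section DepthMap.
Implicit Types T U : poset.

Lemma depth_mono T U (h : T -> U) :
  (forall x y, x [<] y -> h x [<] h y) -> forall x, depth x <= depth (h x).
Proof. by move=> hP; apply: depth_least => x y /hP/depth_lt. Qed.

Lemma depth_iso T U (h : T -> U) x :
  bijective h -> embedding h -> depth (h x) = depth x.
Proof.
case=> g hg gh e; apply/eqP; rewrite eqn_leq; apply/andP; split; last first.
  by apply: depth_mono => a b; rewrite embedding_lt.
rewrite -{2}(hg x); apply: depth_mono => a b.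
by rewrite embedding_lt //; apply: embedding_can gh.
Qed.

Lemma height_iso T U : iso T U -> height T = height U.
Proof.
have le T1 T2 : iso T1 T2 -> height T1 <= height T2.
  by case=> h bh e; apply: height_le => x; rewrite -(depth_iso x bh e) depth_height.
by move=> i; apply/eqP; rewrite eqn_leq !le //; apply: iso_sym.
Qed.

Lemma tall_iso T U (h : T -> U) x :
  bijective h -> embedding h -> tall (h x) = tall x.
Proof.
move=> bh e; rewrite /tall depth_iso // (@height_iso T U) //.
by exists h.
Qed.

(** The sum of the depths decreases strictly, which bounds the depth from above; climbing first in
    one coordinate and then in the other attains it. *)
Lemma depth_prod T U (z : T [*] U) : depth z = depth z.1 + depth z.2.
Proof.
apply/eqP; rewrite eqn_leq; apply/andP; split.
  apply: (depth_least (g := fun z : T [*] U => depth z.1 + depth z.2)).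
  move=> [a b] [a' b'] /andP[/andP[/= l1 l2] ne].
  have := depth_le l1; have := depth_le l2.
  move: l1 l2; rewrite !ple_eqVlt => /orP[/eqP e1|/depth_lt]; last lia.
  move=> /orP[/eqP e2|/depth_lt]; last lia.
  by rewrite e1 e2 eqxx in ne.
case: z => x y /=; move: {2 3}(depth x) (erefl (depth x)) => n.
elim: n x => [|n IH] x dx.
  move: {2 3}(depth y) (erefl (depth y)) => m.
  rewrite add0n; elim: m y => // m IH y dy; have [y' yy' dy'] := depth_step dy.
  apply: leq_ltn_trans (IH _ dy') _; apply: depth_lt.
  case/andP: yy' => le ne; rewrite /plt /= /prod_le /= ple_refl le /=.
  by apply: contra_neq ne => -[].
have [x' xx' dx'] := depth_step dx.
apply: leq_ltn_trans (IH _ dx') _; apply: depth_lt.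
case/andP: xx' => le ne; rewrite /plt /= /prod_le /= ple_refl le /=.
by apply: contra_neq ne => -[].
Qed.

Lemma height_prod T U : T -> U -> height (T [*] U) = height T + height U.
Proof.
move=> t u; apply/eqP; rewrite eqn_leq; apply/andP; split.
  by apply: height_le => z; rewrite depth_prod leq_add ?depth_height.
have [x /eqP <-] := tall_exists t; have [y /eqP <-] := tall_exists u.
by rewrite -(depth_prod (x, y)) depth_height.
Qed.

Lemma tall_prod T U (z : T [*] U) : tall z = tall z.1 && tall z.2.
Proof.
case: z => x y; rewrite /tall depth_prod (height_prod x y) /=.
have := depth_height x; have := depth_height y.
by case: eqP; case: eqP; case: eqP; lia.
Qed.

(** An ascending chain that starts in an up-set stays in it. *)
Lemma depth_sub_up T (S : pred T) (x : sub_poset S) :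
  (forall a b : T, S a -> a [<=] b -> S b) -> depth x = depth (val x).
Proof.
move=> up; apply/eqP; rewrite eqn_leq; apply/andP; split.
  by apply: depth_mono => a b.
move: {2 3}(depth (val x)) (erefl (depth (val x))) => n.
elim: n x => // n IH x dx; have [y xy dy] := depth_step dx.
have Sy := up _ _ (valP x) (plt_le xy).
apply: leq_ltn_trans (IH (exist _ y Sy) dy) _.
exact: depth_lt.
Qed.

Lemma component_up T (x a b : T) :
  connect (@pcmp T) x a -> a [<=] b -> connect (@pcmp T) x b.
Proof.
move=> xa ab; apply: connect_trans xa (connect1 _).
by rewrite /pcmp ab.
Qed.

Lemma depth_component T (x : T) (y : component x) : depth y = depth (val y).
Proof. exact/depth_sub_up/component_up. Qed.

Lemma height_component T (x : T) : height (component x) <= height T.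
Proof. by apply: height_le => y; rewrite depth_component depth_height. Qed.

Lemma height_dual T : height (dual_poset T) = height T.
Proof.
have le U : height U <= height (dual_poset U).
  apply: height_le => x; move: {2}(depth x) (erefl (depth x)) => n dx.
  (* Each step up a chain of length [n] from [x] raises the dual depth by at least one; [y] is the
     top of that chain. *)
  suff [y] : exists y : dual_poset U, depth (x : dual_poset U) + n <= depth y.
    by have := depth_height y; rewrite dx; lia.
  elim: n x dx => [|n IH] x dx; first by exists x; rewrite addn0.
  have [y xy dy] := depth_step dx; have [w hw] := IH y dy; exists w.
  have : @depth (dual_poset U) x < @depth (dual_poset U) y.
    apply: depth_lt; case/andP: xy => l ne; apply/andP; split=> //.
    by rewrite eq_sym.
  by move: hw; lia.
apply/eqP; rewrite eqn_leq le andbT.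
by have := le (dual_poset T); rewrite (height_iso (iso_dualK T)).
Qed.
End DepthMap.

(** * Refinement of product decompositions *)

Section Refinement.
Implicit Types Z A B U V : poset.

(* An isomorphism from [Z] to [A * B], with inverse [mk], given by its coordinates. *)
Record decomp Z A B (f : Z -> A) (g : Z -> B) (mk : A -> B -> Z) : Prop := Decomp {
  decomp_le : forall z w, (z [<=] w) = (f z [<=] f w) && (g z [<=] g w);
  decomp_f : forall a b, f (mk a b) = a;
  decomp_g : forall a b, g (mk a b) = b }.

Lemma decompC Z A B f g mk : @decomp Z A B f g mk -> @decomp Z B A g f (fun b a => mk a b).
Proof. by case=> e ef eg; split=> // z w; rewrite e andbC. Qed.

Lemma decomp_eq Z A B f g mk z w :
  @decomp Z A B f g mk -> f z = f w -> g z = g w -> z = w.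
Proof.
by move=> d ef eg; apply: (@ple_anti Z); rewrite !(decomp_le d) ef eg !ple_refl.
Qed.

Section TwoDecompositions.
Variables (Z A B U V : poset).
Variables (f : Z -> A) (g : Z -> B) (mk : A -> B -> Z) (dAB : decomp f g mk).
Variables (u : Z -> U) (v : Z -> V) (mk' : U -> V -> Z) (dUV : decomp u v mk').

(* [mk' y' q'] is the join of [mk' y' q] and [mk' y q'] when [q <= q'], and
   [mk' y q'] is the meet of [mk' y q] and [mk' y' q'] when [q' <= q]. *)
Lemma parallel_step y y' q q' : y [<=] y' -> pcmp q q' ->
  g (mk' y q) = g (mk' y' q) -> g (mk' y q') = g (mk' y' q').
Proof.
have [fE uE vE] := dUV; have [fE' uE' vE'] := dAB.
have gle a b : a [<=] b -> g a [<=] g b by rewrite fE' => /andP[].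
have fle a b : a [<=] b -> f a [<=] f b by rewrite fE' => /andP[].
have mkle a b c d : (mk' a b [<=] mk' c d) = (a [<=] c) && (b [<=] d).
  by rewrite fE !uE !vE.
move=> yy' qq' e; apply: (@ple_anti B); apply/andP; split.
  by apply: gle; rewrite mkle yy' ple_refl.
case/orP: qq' => qq'.
  have : mk' y' q' [<=] mk (f (mk' y' q')) (g (mk' y q')).
    rewrite fE uE vE; apply/andP; split.
      have : mk' y' q [<=] mk (f (mk' y' q')) (g (mk' y q')).
        by rewrite fE' uE' vE' -e fle ?gle // mkle ?ple_refl ?qq'.
      by rewrite fE uE => /andP[].
    have : mk' y q' [<=] mk (f (mk' y' q')) (g (mk' y q')).
      by rewrite fE' uE' vE' ple_refl fle // mkle yy' ple_refl.
    by rewrite fE vE => /andP[].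
  by rewrite fE' uE' vE' => /andP[].
have : mk (f (mk' y q')) (g (mk' y' q')) [<=] mk' y q'.
  rewrite fE uE vE; apply/andP; split.
    have : mk (f (mk' y q')) (g (mk' y' q')) [<=] mk' y q.
      by rewrite fE' uE' vE' e fle ?gle // mkle ?ple_refl ?qq'.
    by rewrite fE uE => /andP[].
  have : mk (f (mk' y q')) (g (mk' y' q')) [<=] mk' y' q'.
    by rewrite fE' uE' vE' ple_refl fle // mkle yy' ple_refl.
  by rewrite fE vE => /andP[].
by rewrite fE' uE' vE' => /andP[].
Qed.

Hypotheses (cA : connected A) (cV : connected V).

(** [parallel_step] is iterated along a path from [q] to [q'] in the connected poset [V]. *)
Lemma parallel y y' q q' : pcmp y y' ->
  g (mk' y q) = g (mk' y' q) -> g (mk' y q') = g (mk' y' q').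
Proof.
move=> yy' e; apply: (connect_ind (R := fun q => g (mk' y q) = g (mk' y' q)) _ e (cV q q')).
move=> a b ab; case/orP: yy' => yy'; first exact: parallel_step.
by move=> h; symmetry; apply: (parallel_step yy' ab).
Qed.

(** The claim is clear at [z = w]. The [A]-coordinate then moves from [f w] to [f z] along a path
    with the [B]-coordinate fixed; [parallel] handles each step, carrying an equality from the
    [V]-coordinate of the current point to [v w]. *)
Lemma fibre_mix z w : g z = g w -> g (mk' (u z) (v w)) = g w.
Proof.
have [fE uE vE] := dUV; have [fE' uE' vE'] := dAB => ezw.
have -> : z = mk (f z) (g w) by apply: (decomp_eq dAB); rewrite ?uE' ?vE'.
pose R a := g (mk' (u (mk a (g w))) (v w)) = g w.
apply: (connect_ind (R := R) _ _ (cA (f w) (f z))); last first.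
  rewrite /R (_ : mk _ _ = w); last by apply: (decomp_eq dAB); rewrite ?uE' ?vE'.
  by congr g; apply: (decomp_eq dUV); rewrite ?uE ?vE.
rewrite /R => a b ab e1; apply: etrans e1; symmetry.
set z1 := mk a _; set z2 := mk b _.
have c12 : pcmp z1 z2 by rewrite /pcmp /z1 /z2 !fE' !uE' !vE' ple_refl !andbT.
have cu : pcmp (u z1) (u z2).
  by case/orP: c12; rewrite fE => /andP[h _]; rewrite /pcmp h ?orbT.
apply: (@parallel _ _ (v z1) _ cu).
have -> : mk' (u z1) (v z1) = z1 by apply: (decomp_eq dUV); rewrite ?uE ?vE.
have gle x y : x [<=] y -> g x [<=] g y by rewrite fE' => /andP[].
have g12 : g z1 = g z2 by rewrite /z1 /z2 !vE'.
(* The mixed point [mk' (u z2) (v z1)] lies between [z1] and [z2], on which [g] agrees. *)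
apply: (@ple_anti B); case/orP: c12; rewrite fE => /andP[h1 h2].
  rewrite {2}g12 !gle ?fE ?uE ?vE ?h1 ?h2 ?ple_refl //.
by rewrite {1}g12 !gle ?fE ?uE ?vE ?h1 ?h2 ?ple_refl //.
Qed.
End TwoDecompositions.

Definition fibre Z A B (f : Z -> A) (u : Z -> B) (z0 : Z) :=
  sub_poset (fun z => (f z == f z0) && (u z == u z0)).

Lemma fibreC Z A B (f : Z -> A) (u : Z -> B) z0 : iso (fibre f u z0) (fibre u f z0).
Proof. by apply: iso_sub_ext => z; rewrite andbC. Qed.

(** [B] is a copy of the slice [f = f z0]. By [fibre_mix] this slice is closed under mixing [U]- and
    [V]-coordinates, so it is the product of its parts with [u] fixed and with [v] fixed. *)
Lemma fibre_prod Z A B U V f g mk u v mk' (z0 : Z) :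
  @decomp Z A B f g mk -> @decomp Z U V u v mk' ->
  connected B -> connected V -> iso B (fibre f u z0 [*] fibre f v z0).
Proof.
move=> dAB dUV cB cV; apply: iso_sym; have [fE uE vE] := dUV; have [fE' uE' vE'] := dAB.
have mix := fibre_mix (decompC dAB) dUV cB cV.
(* The first fibre fixes [u] and the second fixes [v], so the free coordinates are [v] of the first
   and [u] of the second. *)
pose h (st : fibre f u z0 [*] fibre f v z0) : B := g (mk' (u (val st.2)) (v (val st.1))).
have sP (s : fibre f u z0) : f (val s) = f z0 /\ u (val s) = u z0.
  by case: s => s /= /andP[/eqP-> /eqP->].
have tP (t : fibre f v z0) : f (val t) = f z0 /\ v (val t) = v z0.
  by case: t => s /= /andP[/eqP-> /eqP->].
apply: (@iso_intro _ _ h) => [[s t] [s' t']|b].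
  have [[fs us] [ft vt] [fs' us'] [ft' vt']] := And4 (sP s) (tP t) (sP s') (tP t').
  have mx a b : f a = f z0 -> f b = f z0 -> f (mk' (u a) (v b)) = f z0.
    by move=> ea eb; rewrite mix // ea eb.
  rewrite /h /=;
  transitivity (mk' (u (val t)) (v (val s)) [<=] mk' (u (val t')) (v (val s'))).
    by rewrite fE' !mx ?ple_refl.
  rewrite fE !uE !vE /prod_le /= /sub_le !fE us us' vt vt' !ple_refl.
  by rewrite andbT andbC.
pose m := mk (f z0) b.
have fm : f m = f z0 by rewrite uE'.
pose s := mk' (u z0) (v m); pose t := mk' (u m) (v z0).
have Ps : (f s == f z0) && (u s == u z0) by rewrite /s uE mix ?fm ?eqxx.
have Pt : (f t == f z0) && (v t == v z0) by rewrite /t vE mix ?fm ?eqxx.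
exists (exist _ s Ps, exist _ t Pt); rewrite /h /= /s /t uE vE.
by rewrite (_ : mk' _ _ = m) ?vE' //; apply: (decomp_eq dUV); rewrite ?uE ?vE.
Qed.

(** Each common factor is a fibre that fixes one coordinate of either decomposition: fixing those in
    [X] and [Y] leaves the factor [C] shared by [P] and [Q], and similarly for [D], [E] and [K]. *)
Lemma refinement (X P Y Q : poset) :
    X -> P -> connected X -> connected P -> connected Y -> connected Q ->
    iso (X [*] P) (Y [*] Q) ->
  exists C D E K : poset,
    [/\ iso P (C [*] D), iso Q (C [*] E) & iso Y (D [*] K)].
Proof.
move=> x0 p0 cX cP cY cQ [h [k hk kh] e].
pose Z := X [*] P; pose z0 : Z := (x0, p0).
pose u (z : Z) := (h z).1; pose v (z : Z) := (h z).2.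
have d1 : @decomp Z X P fst snd pair by split.
have d2 : @decomp Z Y Q u v (fun y q => k (y, q)).
  by split=> [z w|y q|y q]; rewrite /u /v ?kh // -e.
have iP := fibre_prod z0 d1 d2 cP cQ.
have iQ := fibre_prod z0 d2 d1 cQ cP.
have iY := fibre_prod z0 (decompC d2) d1 cY cP.
exists (fibre (@fst X P : Z -> X) u z0),
  (fibre (@fst X P : Z -> X) v z0), (fibre u (@snd X P : Z -> P) z0),
  (fibre v (@snd X P : Z -> P) z0).
split=> //.
  by apply: iso_trans iQ (iso_prod (fibreC _ _ _) (iso_refl _)).
by apply: iso_trans iY (iso_prod (fibreC _ _ _) (iso_refl _)).
Qed.
End Refinement.

(** * Join-irreducible elements and self-maps *)

Section JoinIrreducible.
Variable T : poset.
Implicit Types a x y z : T.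

(* In a finite poset [x] is join-irreducible in the up-set of [a] exactly when
   the elements of that up-set strictly below [x] have a greatest element. *)
Definition jirr a x := [exists y, [&& a [<=] y, y [<] x &
  [forall z, (a [<=] z) && (z [<] x) ==> (z [<=] y)]]].

Lemma jirrP a x : reflect (exists y, [/\ a [<=] y, y [<] x &
  forall z, a [<=] z -> z [<] x -> z [<=] y]) (jirr a x).
Proof.
apply: (iffP existsP) => -[y].
  move=> /and3P[h1 h2 /forallP h3]; exists y; split=> // z h4 h5.
  by have := h3 z; rewrite h4 h5.
case=> h1 h2 h3; exists y; rewrite h1 h2; apply/forallP => z.
by apply/implyP => /andP[]; apply: h3.
Qed.

Lemma jirr_gt a x : jirr a x -> a [<] x.
Proof. by case/jirrP=> y [ay yx _]; apply: ple_lt_trans yx. Qed.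

(** An element of maximal depth strictly above [a] covers [a], and then [a] itself is the required
    greatest element. *)
Lemma jirr_exists a x : a [<] x -> exists y, jirr a y.
Proof.
move=> ax; case: (@arg_maxnP _ x [pred y | a [<] y] (@depth T) ax) => /= y ay ymax.
exists y; apply/jirrP; exists a; split=> // [|z]; first exact: ple_refl.
rewrite ple_eqVlt => /orP[/eqP<- _|az /depth_lt]; first exact: ple_refl.
by have := ymax z az; lia.
Qed.
End JoinIrreducible.

(** * The poset of self-maps and its longest chains *)

Section SelfMaps.
Variable T : poset.

Definition mono (f : {ffun T -> T}) :=
  [forall x, forall y, (x [<=] y) ==> (f x [<=] f y)].
Definition map_le : rel {f | mono f} :=
  fun f g => [forall x, val f x [<=] val g x].
Fact map_refl : reflexive map_le.
Proof. by move=> f; apply/forallP => x; apply: ple_refl. Qed.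
Fact map_anti : antisymmetric map_le.
Proof.
move=> f g /andP[/forallP fg /forallP gf]; apply/val_inj/ffunP => x.
by apply: ple_anti; rewrite fg gf.
Qed.
Fact map_trans : transitive map_le.
Proof.
move=> g f h /forallP fg /forallP gh; apply/forallP => x.
exact: ple_trans (gh x).
Qed.
Definition map_poset := Poset map_refl map_anti map_trans.

Definition ap (f : map_poset) : T -> T := val f.
(** Amounts to being constant on each component, since components are generated by comparable
    pairs. *)
Definition lconst (f : map_poset) := forall x y, x [<=] y -> ap f x = ap f y.

Implicit Types f g : map_poset.

Lemma map_leP f g : reflect (forall x, ap f x [<=] ap g x) (f [<=] g).
Proof. exact: forallP. Qed.

Lemma ap_mono f x y : x [<=] y -> ap f x [<=] ap f y.
Proof. by move=> xy; have /forallP/(_ x)/forallP/(_ y) := valP f; rewrite xy. Qed.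

Lemma ap_inj f g : ap f =1 ap g -> f = g.
Proof. by move=> e; apply/val_inj/ffunP. Qed.

Lemma map_of (h : T -> T) :
  (forall x y, x [<=] y -> h x [<=] h y) -> {f : map_poset | ap f =1 h}.
Proof.
move=> hm; have m : mono (finfun h).
  by apply/forallP => x; apply/forallP => y; apply/implyP => xy; rewrite !ffunE hm.
by exists (exist mono _ m) => x; rewrite /ap /= ffunE.
Qed.

Lemma map_ltP f g : f [<] g -> exists2 p, ap f p [<] ap g p & f [<=] g.
Proof.
case/andP => le ne; have [p hp|h] := pickP [pred p | ap f p != ap g p].
  by exists p => //; apply/andP; split=> //; apply/map_leP.
case/eqP: ne; apply: ap_inj => p; apply/eqP.
by have := h p; rewrite /= => /negbFE.
Qed.

Lemma depth_map_le f : depth f <= \sum_p depth (ap f p).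
Proof.
apply: (depth_least (g := fun f : map_poset => \sum_p depth (ap f p))) => {}f g.
case/map_ltP => p lt le; rewrite (bigD1 p) //= [X in _ < X](bigD1 p) //=.
rewrite -addSn leq_add ?depth_lt // leq_sum // => q _.
by rewrite depth_le //; apply/map_leP.
Qed.

Lemma depth_map_diff f g :
  f [<=] g -> #|[pred p | ap f p != ap g p]| + depth g <= depth f.
Proof.
move: {2}#|_| (erefl #|[pred p | ap f p != ap g p]|) => n.
elim: n f => [|n IH] f dn fg; first by rewrite dn depth_le.
have [p0 Pp0] : exists p, p \in [pred p | ap f p != ap g p].
  by apply/card_gt0P; rewrite dn.
(* Raising [f] to [g] at a maximal point of disagreement keeps it monotone. *)
case: (@arg_minnP _ p0 [pred p | ap f p != ap g p] (@depth T) Pp0) => /= p Pp pmin.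
have fg' := map_leP _ _ fg.
have above q : p [<] q -> ap f q = ap g q.
  move=> pq; apply/eqP/negPn/negP => /pmin; have := depth_lt pq; lia.
pose h q := if q == p then ap g p else ap f q.
have [k kE] : {k | ap k =1 h}.
  apply: map_of => x y xy; rewrite /h; case: eqP => [ex|nx]; case: eqP => [ey|ny].
  - exact: ple_refl.
  - rewrite above; first by apply: ap_mono; rewrite -ex.
    by rewrite /plt -ex xy /=; apply/eqP => e; apply: ny; rewrite -e.
  - by apply: ple_trans (fg' p); apply: ap_mono; rewrite -ey.
  - exact: ap_mono.
have kg : k [<=] g.
  by apply/map_leP => q; rewrite kE /h; case: eqP => [->|_] //; apply: ple_refl.
have fk : f [<] k.
  apply/andP; split.
    by apply/map_leP => q; rewrite kE /h; case: eqP => [->|_] //; apply: ple_refl.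
  by apply: contra_neq Pp => e; rewrite {1}e kE /h eqxx.
have card : #|[pred q | ap f q != ap g q]| = #|[pred q | ap k q != ap g q]|.+1.
  rewrite (cardD1 p) inE Pp add1n; congr _.+1; apply: eq_card => q.
  by rewrite !inE kE /h; case: eqP => // ->; rewrite eqxx.
rewrite card; apply: leq_ltn_trans (depth_lt fk); apply: IH => //.
by move: card; rewrite dn => -[].
Qed.

(** Raising every value at once is worth [#|T|] steps by [depth_map_diff], and this can be done [n]
    times. *)
Lemma depth_map_lconst n f :
  lconst f -> (forall p, n <= depth (ap f p)) -> n * #|T| <= depth f.
Proof.
elim: n f => // n IH f fc fn.
(* [next] is applied to the value of [f], so the result is again constant on components. *)
pose next (x : T) := odflt x [pick y | (x [<] y) && (n <= depth y)].
have nextP p : ap f p [<] next (ap f p) /\ n <= depth (next (ap f p)).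
  rewrite /next; case: pickP => [y /andP[]//|no]; have := fn p.
  case e : (depth (ap f p)) => [|m] // nm; have [y xy dy] := depth_step e.
  by have := no y; rewrite /= xy dy -ltnS nm.
have [g gE] : {g | ap g =1 fun p => next (ap f p)}.
  by apply: map_of => x y xy; rewrite (fc _ _ xy) ple_refl.
have fg : f [<=] g by apply/map_leP => p; rewrite gE; apply/plt_le; case: (nextP p).
have := depth_map_diff fg; rewrite (eq_card (B := T)); last first.
  by move=> p; rewrite !inE gE; case: (nextP p) => /andP[_ ->].
rewrite mulSn; apply: leq_trans; rewrite leq_add2l; apply: IH => [x y xy|p].
  by rewrite !gE (fc _ _ xy).
by rewrite gE; case: (nextP p).
Qed.

Lemma const_exists a : {f : map_poset | forall p, ap f p = a}.
Proof. by apply: map_of => x y _; apply: ple_refl. Qed.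

Hypothesis t0 : T.

Lemma height_map : height map_poset = height T * #|T|.
Proof.
apply/eqP; rewrite eqn_leq; apply/andP; split.
  apply: height_le => f; apply: leq_trans (depth_map_le f) _.
  apply: (@leq_trans (\sum_(p : T) height T)); last by rewrite sum_nat_const mulnC.
  by apply: leq_sum => p _; apply: depth_height.
have [a /eqP ta] := tall_exists t0; have [f fE] := const_exists a.
apply: leq_trans (depth_height f); apply: depth_map_lconst => [x y _|p].
  by rewrite !fE.
by rewrite fE ta.
Qed.

(** Equality in [depth_map_le] forces every value to be tall; tall elements are minimal, so
    comparable values coincide. *)
Lemma tall_map f : tall f -> lconst f /\ forall p, tall (ap f p).
Proof.
move=> /eqP; rewrite height_map => tf.
have ta p : tall (ap f p).
  apply/negPn/negP => np; have := depth_map_le f; rewrite tf (bigD1 p) //=.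
  have lt : depth (ap f p) < height T by rewrite ltn_neqAle np depth_height.
  have : \sum_(i | i != p) depth (ap f i) <= \sum_(i | i != p) height T.
    by apply: leq_sum => i _; apply: depth_height.
  have : \sum_(i : T) height T = height T * #|T| by rewrite sum_nat_const mulnC.
  by rewrite (bigD1 p) //=; lia.
by split=> // x y xy; apply: tall_minimal => //; apply: ap_mono.
Qed.

Lemma lconst_tall f : lconst f -> (forall p, tall (ap f p)) -> tall f.
Proof.
move=> fc ft; rewrite /tall eqn_leq depth_height height_map.
by apply: depth_map_lconst => // p; rewrite (eqP (ft p)).
Qed.

Lemma lconst_connected f : connected T -> lconst f -> forall p, ap f p = ap f t0.
Proof.
move=> c fc p; apply: (connect_ind (R := fun p => ap f p = ap f t0)) (c t0 p)
  => // a b ab <-.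
by case/orP: ab => /fc.
Qed.
End SelfMaps.

(** * Join-irreducible self-maps are spikes *)

Section JirrMap.
Variables (T : poset) (f : map_poset T).
Hypothesis fc : lconst f.

Definition spike p x q := if p [<=] q then x else ap f q.

Lemma spike_mono p x q r :
  ap f p [<=] x -> q [<=] r -> spike p x q [<=] spike p x r.
Proof.
move=> px qr; rewrite /spike; case: ifP => [pq|npq].
  by rewrite (ple_trans pq qr) ple_refl.
case: ifP => [pr|_]; last exact: ap_mono.
by rewrite (fc qr) -(fc pr).
Qed.

Lemma spike_le p x q y : ap f p [<] x -> ap f q [<=] y ->
  (forall r, spike p x r [<=] spike q y r) <-> (q [<=] p) && (x [<=] y).
Proof.
move=> px qy; split => [h|/andP[qp xy] r].
  have := h p; rewrite /spike ple_refl; case: ifP => //= _ xp.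
  by have := ple_lt_false xp px.
rewrite /spike; case: ifP => [pr|npr]; first by rewrite (ple_trans qp pr).
by case: ifP => [qr|_]; rewrite ?ple_refl // -(fc qr).
Qed.

Lemma jirr_spike F p x : ap F =1 spike p x -> jirr (ap f p) x -> jirr f F.
Proof.
move=> FE jx; have px := plt_le (jirr_gt jx); case/jirrP: jx => y [py yx ymax].
(* The greatest map above [f] and strictly below the spike: only the value at [p] drops, to the
   greatest element [y] available below [x]. *)
pose h q := if p [<] q then x else if q == p then y else ap f q.
have [G GE] : {G | ap G =1 h}.
  apply: map_of => q r qr; rewrite /h; case: ifP => [pq|npq].
    by rewrite (plt_le_trans pq qr) ple_refl.
  case: eqP => [eq|nq].
    case: ifP => [_|npr]; first exact: plt_le.
    by case: eqP => [_|nr]; rewrite ?ple_refl //; move: npr;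
      rewrite -eq /plt qr; case: eqP => // e _; case: nr; rewrite -e.
  case: ifP => [pr|_]; first by rewrite (fc qr) -(fc (plt_le pr)).
  by case: eqP => [er|_]; [rewrite (fc qr) er|apply: ap_mono].
apply/jirrP; exists G; split.
- apply/map_leP => q; rewrite GE /h; case: ifP => [/plt_le/fc<-//|_].
  by case: eqP => [->//|_]; apply: ple_refl.
- apply/andP; split.
    apply/map_leP => q; rewrite GE FE /h /spike; case: ifP => [/plt_le->|_];
      first exact: ple_refl.
    case: eqP => [->|/eqP nq]; first by rewrite ple_refl plt_le.
    by case: ifP => [/fc<-//|_]; apply: ple_refl.
  apply/eqP => e; have := GE p; rewrite e FE /spike /h plt_irr ple_refl eqxx => exy.
  by rewrite exy plt_irr in yx.
move=> k /map_leP fk kF; have /map_leP kF' := plt_le kF.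
have kp : ap k p [<] x.
  apply/andP; split; first by have := kF' p; rewrite FE /spike ple_refl.
  apply/eqP => kx; suff e : k = F by rewrite e plt_irr in kF.
  apply: ap_inj => q; apply: ple_anti; rewrite kF' FE /spike.
  by case: ifP => [pq|_]; rewrite -?kx ?ap_mono ?fk.
apply/map_leP => q; rewrite GE /h; have := kF' q; rewrite FE.
case: ifP => [pq|npq]; first by rewrite /spike (plt_le pq).
case: eqP => [->|/eqP nq]; first by rewrite ymax.
by rewrite /spike; case: ifP => // pq; rewrite /plt pq eq_sym nq in npq.
Qed.

(** [p] is a point where [F] exceeds its greatest predecessor [G]. Spikes at [p] below [F] are
    compared with [G], which shows both that [F] is a spike and that its value at [p] is
    join-irreducible. *)
Lemma jirr_is_spike F : jirr f F ->
  exists p, jirr (ap f p) (ap F p) /\ ap F =1 spike p (ap F p).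
Proof.
case/jirrP=> G [/map_leP fG GF Gmax]; have [p Gp /map_leP GF'] := map_ltP GF.
have /map_leP fF : f [<=] F by apply: ple_trans (plt_le GF); apply/map_leP.
(* Such a [k] cannot lie below [G], since [G] is smaller at [p]. *)
have eqF k : f [<=] k -> k [<=] F -> ap k p = ap F p -> k = F.
  rewrite ple_eqVlt => fk; rewrite ple_eqVlt => /orP[/eqP//|kF] kp.
  have /map_leP/(_ p) : k [<=] G by apply: Gmax => //; rewrite ple_eqVlt.
  by rewrite kp => /ple_lt_false/(_ Gp).
have spk x : ap f p [<=] x -> x [<=] ap F p ->
    exists k, [/\ ap k =1 spike p x, f [<=] k & k [<=] F].
  move=> fx xF; have [k kE] := map_of (fun q r => @spike_mono p x q r fx).
  exists k; split=> //; apply/map_leP => q; rewrite kE /spike; case: ifP => [pq|_].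
  - by rewrite -(fc pq).
  - exact: ple_refl.
  - by apply: ple_trans xF (ap_mono F pq).
  - exact: fF.
have fpF := fF p; exists p; split.
  apply/jirrP; exists (ap G p); split=> // z fz zF.
  have [k [kE fk kF]] := spk z fz (plt_le zF).
  have kp : ap k p = z by rewrite kE /spike ple_refl.
  have /map_leP/(_ p) : k [<=] G.
    apply: Gmax => //; rewrite /plt kF /=; apply/eqP => e.
    by rewrite -kp e plt_irr in zF.
  by rewrite kp.
have [k [kE fk kF]] := spk _ fpF (ple_refl _).
by rewrite -(eqF k fk kF) // kE /spike ple_refl.
Qed.

(** A spike grows when its value rises or its base point descends, hence the dual in the first
    factor. *)
Lemma jirr_map_iso : iso (sub_poset (T := map_poset T) (jirr f))
  (sub_poset (T := dual_poset T [*] T) (fun z => jirr (ap f z.1) z.2)).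
Proof.
apply: iso_sym; set J := sub_poset (T := _ [*] _) _.
have ex (z : J) : {F : map_poset T | jirr f F & ap F =1 spike (val z).1 (val z).2}.
  have jz := valP z.
  have [F FE] := map_of (fun q r => @spike_mono _ _ q r (plt_le (jirr_gt jz))).
  by exists F => //; apply: jirr_spike FE jz.
pose h z : sub_poset (T := map_poset T) (jirr f) := exist (jirr f) _ (s2valP (ex z)).
have hE z : ap (val (h z)) =1 spike (val z).1 (val z).2 by rewrite /h /=; case: (ex z).
apply: (@iso_intro _ _ h) => [z w|[F jF]].
  have [lz lw] := (jirr_gt (valP z), plt_le (jirr_gt (valP w))).
  have := spike_le lz lw; rewrite /ple /= /sub_le /= /prod_le /= => -[l1 l2].
  apply/map_leP/idP => [h1|h1 q]; last by rewrite !hE; apply: l2.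
  by apply: l1 => q; rewrite -!hE.
have [p [jp FE]] := jirr_is_spike jF.
exists (exist (fun z : dual_poset T [*] T => jirr (ap f z.1) z.2) (p, ap F p) jp).
by apply/val_inj/ap_inj => q; rewrite hE -FE.
Qed.
End JirrMap.

(** * Comparison of two posets of self-maps *)

Definition jposet (T : poset) (a : T) := sub_poset (jirr a).

(** * Join-irreducibles under isomorphisms, in components and in products *)

Section JirrTransport.
Implicit Types T U : poset.

Lemma jirr_embedding T U (h : T -> U) a x :
  bijective h -> embedding h -> jirr a x -> jirr (h a) (h x).
Proof.
case=> g hg gh e /jirrP[y [ay yx ymax]]; apply/jirrP; exists (h y).
rewrite e embedding_lt //; split=> // z; rewrite -(gh z) !e embedding_lt //.
exact: ymax.
Qed.

Lemma jposet_iso T U (h : T -> U) a :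
  bijective h -> embedding h -> iso (jposet a) (jposet (h a)).
Proof.
move=> bh e; apply: (iso_sub e) => [x|u]; first exact: jirr_embedding.
case: (bh) => g hg gh ju; exists (g u) => //; rewrite -(hg a).
by apply: jirr_embedding ju; [exists h|apply: embedding_can gh].
Qed.

Lemma jirr_sub_up T (S : pred T) (a x : sub_poset S) :
  (forall b c : T, S b -> b [<=] c -> S c) -> jirr a x = jirr (val a) (val x).
Proof.
move=> up; apply/jirrP/jirrP => -[y [ay yx ymax]].
  exists (val y); split=> // z az zx.
  have Sz := up _ _ (valP a) az; exact: (ymax (exist _ z Sz)).
have Sy := up _ _ (valP a) ay; exists (exist _ y Sy).
by split=> // z; apply: ymax.
Qed.

Definition base T (x : T) : component x := exist _ x (connect0 _ x).

Lemma jposet_component T (x : T) : iso (jposet (base x)) (jposet x).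
Proof.
have up := @component_up T x.
apply: (iso_sub (h := fun y : component x => val y)) => // [y|u].
  by rewrite jirr_sub_up.
move=> ju; have cu := up _ _ (connect0 _ x) (plt_le (jirr_gt ju)).
by exists (exist _ u cu) => //; rewrite jirr_sub_up.
Qed.

Lemma tall_base T (x : T) : tall x -> tall (base x) /\ height (component x) = height T.
Proof.
move=> /eqP tx; have hc := height_component x.
have := depth_height (base x); rewrite /tall depth_component /= tx => hT.
have -> : height (component x) = height T by lia.
by rewrite eqxx.
Qed.

(** If both coordinates of [z] exceeded those of [(a, b)], then [(z.1, b)] and [(a, z.2)] would lie
    strictly below [z] with join [z]. *)
Lemma jirr_prodP T U (a : T) (b : U) (z : T [*] U) :
  reflect (z.1 = a /\ jirr b z.2 \/ z.2 = b /\ jirr a z.1)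
    (jirr ((a, b) : T [*] U) z).
Proof.
case: z => x y /=; apply: (iffP (jirrP _ _)) => [[[x' y'] [ge lt max]]|].
  have /andP[/= ax byy] := ple_trans ge (plt_le lt).
  have [ltx|] := boolP (a [<] x); have [lty|] := boolP (b [<] y).
  - have h1 : ((x, b) : T [*] U) [<=] (x', y').
      apply: max; rewrite /plt /= /prod_le /= ?ax ?ple_refl ?byy //=.
      by apply: contraTneq lty => -[->]; rewrite plt_irr.
    have h2 : ((a, y) : T [*] U) [<=] (x', y').
      apply: max; rewrite /plt /= /prod_le /= ?ax ?ple_refl ?byy //=.
      by apply: contraTneq ltx => -[->]; rewrite plt_irr.
    case/andP: h1 => /= h1 _; case/andP: h2 => /= _ h2.
    have : ((x, y) : T [*] U) [<=] (x', y') by apply/andP.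
    by move/ple_lt_false/(_ lt).
  - rewrite ple_eqVlt in byy; case/orP: byy => [/eqP eb _|-> //].
    subst y; right; split=> //; apply/jirrP; exists x'.
    case/andP: (plt_le lt) => /= xx yb; case/andP: ge => /= ax' yb'.
    have ey : y' = b by apply: ple_anti; rewrite yb.
    subst y'; split=> // [|z az zx].
      by rewrite /plt xx /=; apply: contraTneq lt => ->; rewrite plt_irr.
    have /andP[//] : ((z, b) : T [*] U) [<=] (x', b).
    apply: max; rewrite /plt /= /prod_le /= ?az ?(plt_le zx) ?ple_refl //=.
    by apply: contraTneq zx => -[->]; rewrite plt_irr.
  - rewrite ple_eqVlt in ax; case/orP: ax => [/eqP ea|-> //] nlt.
    subst x; left; split=> //; apply/jirrP; exists y'.
    case/andP: (plt_le lt) => /= xa yy; case/andP: ge => /= xa' ay'.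
    have ex : x' = a by apply: ple_anti; rewrite xa.
    subst x'; split=> // [|z az zx].
      by rewrite /plt yy /=; apply: contraTneq lt => ->; rewrite plt_irr.
    have /andP[//] : ((a, z) : T [*] U) [<=] (a, y').
    apply: max; rewrite /plt /= /prod_le /= ?az ?(plt_le zx) ?ple_refl //=.
    by apply: contraTneq zx => -[->]; rewrite plt_irr.
  rewrite ple_eqVlt in ax; case/orP: ax => [/eqP ea|-> //] nb na.
  rewrite ple_eqVlt in byy; case/orP: byy => [/eqP eb|lb]; last by rewrite lb in nb.
  by subst x y; have := ple_lt_trans ge lt; rewrite plt_irr.
case=> -[-> /jirrP[w [ge lt max]]].
  exists (a, w); split.
  - by rewrite /= /prod_le /= ge ple_refl.
  - rewrite /plt /= /prod_le /= (plt_le lt) ple_refl /=.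
    by apply: contraTneq lt => -[->]; rewrite plt_irr.
  move=> [p q] /andP[/= ap bq] /andP[/andP[/= pa qy] ne].
  have ep : p = a by apply: ple_anti; rewrite pa.
  subst p; rewrite /prod_le /= ple_refl max //.
  by rewrite /plt qy; apply: contra_neq ne => ->.
exists (w, b); split.
- by rewrite /= /prod_le /= ge ple_refl.
- rewrite /plt /= /prod_le /= (plt_le lt) ple_refl /=.
  by apply: contraTneq lt => -[->]; rewrite plt_irr.
move=> [p q] /andP[/= ap bq] /andP[/andP[/= px qb] ne].
have eq : q = b by apply: ple_anti; rewrite qb.
subst q; rewrite /prod_le /= ple_refl max //.
by rewrite /plt px; apply: contra_neq ne => ->.
Qed.

Lemma iso_prod1 T U : U -> #|U| <= 1 -> iso (T [*] U) T.
Proof.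
move=> u /card_le1_eqP h; apply: iso_sym.
apply: (@iso_intro _ (T [*] U) (fun t => (t, u))) => [x y|[t u']].
  by rewrite /= /prod_le /= ple_refl andbT.
by exists t; rewrite (h u u').
Qed.
End JirrTransport.

(** Not yet a product, because a locally constant [f] may take different values on different
    components. *)
Definition jpairs (T : poset) (f : map_poset T) :=
  sub_poset (T := dual_poset T [*] T) (fun z => jirr (ap f z.1) z.2).

Lemma jpairs_const (T : poset) (f : map_poset T) a :
  (forall p, ap f p = a) -> iso (jpairs f) (dual_poset T [*] jposet a).
Proof.
move=> fa; apply: iso_sym.
have hP (z : dual_poset T [*] jposet a) : jirr (ap f z.1) (val z.2).
  by rewrite fa (valP z.2).
pose h (z : dual_poset T [*] jposet a) : jpairs f :=
  exist (fun z : dual_poset T [*] T => jirr (ap f z.1) z.2) (z.1, val z.2) (hP z).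
apply: (@iso_intro (dual_poset T [*] jposet a) _ h) => // -[[p x] jx].
have jx' : jirr a x by rewrite -(fa p).
by exists (p, exist _ x jx'); apply: val_inj.
Qed.

Definition jheight (T : poset) := \max_(a : T | tall a) height (jposet a).

(* A chain of [jpairs g] has its first coordinates in one component of [T], on
   which [g] is constant. *)
Lemma height_jpairs (T : poset) (g : map_poset T) :
  lconst g -> (forall p, tall (ap g p)) -> height (jpairs g) <= height T + jheight T.
Proof.
move=> gc gt.
(* Depth in [jposet a] extended by 0 to all of [T], so that [a] can be rewritten without dependent
   types. *)
pose D (a y : T) := oapp (@depth (jposet a)) 0 (insub y).
pose G (z : jpairs g) := @depth (dual_poset T) (val z).1 + D (ap g (val z).1) (val z).2.
have DE a y (jy : jirr a y) : D a y = @depth (jposet a) (exist _ y jy).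
  by rewrite /D insubT.
have le z : depth z <= G z.
  apply: (depth_least (g := G)) => {z} [[[p x] jx] [[q y] jy]] lt.
  rewrite /G /=; case/andP: lt => /andP[/= pq xy] ne.
  have epq : ap g q = ap g p by apply: gc.
  have jy' : jirr (ap g p) y by rewrite -epq.
  have jx' : jirr (ap g p) x by [].
  rewrite epq (DE _ _ jx') (DE _ _ jy').
  have pq' : @ple (dual_poset T) p q := pq.
  have := depth_le pq'; have : (exist _ x jx' : jposet (ap g p)) [<=] exist _ y jy' by [].
  rewrite ple_eqVlt => /orP[/eqP[exy]|/depth_lt]; last lia.
  move: pq'; rewrite ple_eqVlt => /orP[/eqP e|/depth_lt]; last first.
    by subst y; rewrite (bool_irrelevance jx' jy'); lia.
  by subst q y; case/eqP: ne; apply: val_inj.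
apply: height_le => z; apply: leq_trans (le z) _; rewrite /G leq_add //.
  by rewrite -(height_dual T) depth_height.
rewrite (DE _ _ (valP z)); apply: leq_trans (depth_height _) _.
exact: (leq_bigmax_cond (F := fun a : T => height (jposet a))).
Qed.

Lemma component_refinement (P Q : poset) (a : P) (a' : Q) (y0 : jposet a') :
    connected P -> tall a' ->
    iso (dual_poset P [*] jposet a) (dual_poset Q [*] jposet a') ->
  exists (C D E K : poset) (c : C) (e : E),
    [/\ iso P (C [*] D), iso (component a') (C [*] E),
        iso (component y0) (dual_poset D [*] K),
        iso (@jposet (C [*] E) (c, e)) (jposet a') & tall ((c, e) : C [*] E)].
Proof.
move=> cP ta i.
(* The factors are swapped to put the duals of [P] and [Q] second, as in [refinement]. *)
have [h bh eh] := iso_trans (iso_prodC _ _) (iso_trans i (iso_prodC _ _)).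
have [k hk kh] := bh.
pose x0 := (k (y0, a')).1; pose p := (k (y0, a')).2.
have hxp : h (x0, p) = (y0, a') by rewrite -surjective_pairing kh.
have ic : iso (component x0 [*] @component (dual_poset P) p)
              (component y0 [*] @component (dual_poset Q) a').
  apply: iso_trans (component_prod _ _).
  rewrite -hxp; apply: iso_trans (component_iso _ bh eh).
  exact: iso_sym (component_prod _ _).
have [C [D [E [K [iP iQ iY]]]]] :=
  refinement (base x0) (@base (dual_poset P) p) (@component_connected _ _)
    (@component_connected _ _) (@component_connected _ _)
    (@component_connected _ _) ic.
have iQ' : iso (component a') (dual_poset C [*] dual_poset E).
  by apply: iso_trans (iso_dual iQ); apply: iso_dual (iso_sym (component_dual a')).
have [g bg eg] := iQ'.
(* [refinement] was applied to the duals of [P] and of the component of [a'], so [C], [D] and [E]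
   are dualised back. *)
exists (dual_poset C), (dual_poset D), (dual_poset E), K, (g (base a')).1, (g (base a')).2.
rewrite -surjective_pairing; split=> //.
- have cdP := connected_dual cP.
  exact: iso_dual (iso_trans (iso_sym (component_full p cdP)) iP).
- apply: iso_trans (jposet_component a').
  exact/iso_sym/jposet_iso.
by rewrite tall_iso //; case: (tall_base ta).
Qed.

(** No comparability leads from the copy of [J e] to that of [J c], so the component keeps first
    coordinate [c] and injects into [E] without [e]. *)
Lemma card_jcomponent (C E : poset) (c : C) (e u : E)
    (ju : jirr ((c, e) : C [*] E) (c, u)) (eu : e [<] u) :
  #|component (exist (jirr ((c, e) : C [*] E)) _ ju : @jposet (C [*] E) (c, e))| < #|E|.
Proof.
pose z := exist (jirr ((c, e) : C [*] E)) _ ju; pose J := @jposet (C [*] E) (c, e).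
pose fst' (w : J) := (val w).1; pose snd' (w : J) := (val w).2.
have inv (w : J) : connect (@pcmp J) z w -> fst' w = c /\ e [<] snd' w.
  apply: (connect_ind (R := fun w : J => fst' w = c /\ e [<] snd' w)) => //.
  move=> [[x1 y1] j1] [[x2 y2] j2]; rewrite /fst' /snd' /= => cmp [ex lt]; subst x1.
  case/jirr_prodP: (j2) => -[/= e2 j].
    by rewrite e2; split=> //; apply: jirr_gt.
  case/orP: cmp => /andP[/= l1]; rewrite e2 => l2; first by have := ple_lt_false l2 lt.
  by have := ple_lt_false l1 (jirr_gt j).
pose f (w : component (z : J)) : E := snd' (val w).
have fi : injective f.
  move=> w1 w2 ew; apply/val_inj/val_inj.
  have [e1 _] := inv _ (valP w1); have [e2 _] := inv _ (valP w2).
  by rewrite [LHS]surjective_pairing [RHS]surjective_pairing; congr pair;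
     rewrite -?/(fst' _) ?e1 ?e2.
rewrite -(card_image fi); apply/proper_card/properP; split; first exact/subsetP.
exists e => //; apply/imageP => -[w _ ew].
by have [_] := inv _ (valP w); rewrite -/(f w) -ew plt_irr.
Qed.

Lemma height_jposet_prodl (C D : poset) (c : C) (d : D) :
  height (jposet c) <= height (@jposet (C [*] D) (c, d)).
Proof.
have jP (u : jposet c) : jirr ((c, d) : C [*] D) (val u, d).
  by apply/jirr_prodP; right; split=> //; apply: valP u.
pose f u : @jposet (C [*] D) (c, d) := exist (jirr ((c, d) : C [*] D)) _ (jP u).
apply: height_le => u; apply: leq_trans (depth_height (f u)).
apply: depth_mono => u1 u2 /andP[l ne]; apply/andP; split.
  by apply/andP; rewrite /= ple_refl.
by apply: contra_neq ne => -[ee]; apply: val_inj.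
Qed.

(** The poset splits into unrelated copies of [J c] and [J e]; the latter lies strictly above [e],
    which costs one step. *)
Lemma height_jposet_prod (C E : poset) (c : C) (e : E) :
  height (@jposet (C [*] E) (c, e)) <= maxn (height E).-1 (height (jposet c)).
Proof.
apply: height_le => z.
pose J := @jposet (C [*] E) (c, e).
pose F (a : C) := oapp (@depth (jposet c)) 0 (insub a).
have FE b (jb : jirr c b) : F b = @depth (jposet c) (exist _ b jb).
  by rewrite /F insubT.
pose G (w : J) := if (val w).1 == c then depth (val w).2 else F (val w).1.
have leG : depth z <= G z.
  apply: (depth_least (g := G)) => {z} -[[x1 y1] j1] [[x2 y2] j2] /andP[/andP[/= lx ly] ne].
  rewrite /G /=.
  case/jirr_prodP: (j1) => -[/= e1 j1']; case/jirr_prodP: (j2) => -[/= e2 j2']; subst.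
  - rewrite eqxx; apply: depth_lt; rewrite /plt ly /=.
    by apply: contra_neq ne => ee; subst; apply: val_inj.
  - by have := ple_lt_false ly (jirr_gt j1').
  - by have := ple_lt_false lx (jirr_gt j1').
  have gt1 := jirr_gt j1'; have gt2 := jirr_gt j2'.
  have n1 : (x1 == c) = false by apply: contraTF gt1 => /eqP->; rewrite plt_irr.
  have n2 : (x2 == c) = false by apply: contraTF gt2 => /eqP->; rewrite plt_irr.
  rewrite n1 n2 (FE _ j1') (FE _ j2'); apply: depth_lt; rewrite /plt /= /sub_le /= lx /=.
  by apply: contra_neq ne => -[ee]; subst; apply: val_inj.
apply: leq_trans leG _; rewrite /G leq_max; case: z => -[x1 y1] j1 /=.
case/jirr_prodP: (j1) => -[/= e1 j1']; subst.
  rewrite eqxx; have := depth_lt (jirr_gt j1'); have := depth_height e; lia.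
have n1 : (x1 == c) = false by apply: contraTF (jirr_gt j1') => /eqP->; rewrite plt_irr.
by rewrite n1 (FE _ j1') depth_height orbT.
Qed.

(** * Consequences of an isomorphism between the posets of self-maps *)

Section SelfMapIso.
Variables (P Q : poset) (phi : map_poset P -> map_poset Q).
Hypotheses (phi_bij : bijective phi) (phi_emb : embedding phi).
Hypotheses (p0 : P) (q0 : Q) (cP : connected P).

Lemma height_card_eq : height P * #|P| = height Q * #|Q|.
Proof.
rewrite -(height_map p0) -(height_map q0); apply: height_iso.
by exists phi.
Qed.

Lemma jpairs_iso f : tall f -> iso (jpairs f) (jpairs (phi f)).
Proof.
move=> tf; have tg : tall (phi f) by rewrite tall_iso.
have [fc _] := tall_map p0 tf; have [gc _] := tall_map q0 tg.
apply: iso_trans (iso_sym (jirr_map_iso fc)) _.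
by apply: iso_trans (jirr_map_iso gc); apply: jposet_iso.
Qed.

(** The constant map at [a'] is tall, so it comes from a tall map of [P], which is constant because
    [P] is connected. The transfer runs from [Q] to [P], as [Q] is not known to be connected. *)
Lemma tall_transfer (a' : Q) : tall a' -> exists2 a : P, tall a &
  iso (dual_poset P [*] jposet a) (dual_poset Q [*] jposet a').
Proof.
move=> ta'; have [g gE] := const_exists a'.
have tg : tall g by apply: (lconst_tall q0) => [x y _|p]; rewrite !gE.
have [psi pK Kp] := phi_bij; pose f := psi g.
have tf : tall f by rewrite -(tall_iso _ phi_bij phi_emb) Kp.
have [fc ft] := tall_map p0 tf.
have fE := lconst_connected p0 cP fc.
exists (ap f p0) => //.
apply: iso_trans (iso_sym (jpairs_const fE)) _.
by apply: iso_trans (jpairs_const gE); rewrite -(Kp g); apply: jpairs_iso.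
Qed.

(** The left side is the height of [jpairs f] for [f] constant at an optimal tall [a]. Its image
    [phi f] is only locally constant, so [height_jpairs] gives an inequality. *)
Lemma jheight_le : 0 < height P -> height P + jheight P <= height Q + jheight Q.
Proof.
move=> hP; have [a0 ta0] := tall_exists p0.
rewrite /jheight (bigmax_eq_arg a0) //; case: arg_maxnP => // a ta _.
have [x ax] := height_gt0_step ta hP; have [j jj] := jirr_exists ax.
have [f fE] := const_exists a.
have tf : tall f by apply: (lconst_tall p0) => [x' y _|p]; rewrite !fE.
have tg : tall (phi f) by rewrite tall_iso.
have [gc gt] := tall_map q0 tg.
rewrite -(height_dual P)
  -(height_prod (p0 : dual_poset P) (exist (jirr _) j jj : jposet a)).
rewrite -(height_iso (jpairs_const fE)) (height_iso (jpairs_iso tf)).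
exact: height_jpairs.
Qed.

(* Otherwise [height Q < height P].  Choose [a'] with [height (J a')] maximal and
   [Y] of that height; the bound [max (height E - 1) (height (J c))] on it is
   too small: the first contradicts [height D <= height Y] and
   [height E < height D], the second [height_jposet_prodl] and [jheight_le]. *)
Lemma card_selfmap_le : 0 < height Q -> #|Q| <= #|P|.
Proof.
move=> hQ; rewrite leqNgt; apply/negP => ltPQ.
have hPQ : height Q < height P.
  by have := height_card_eq; nia.
have le := jheight_le (leq_trans hQ (ltnW hPQ)).
have [b0 tb0] := tall_exists q0.
case: (@arg_maxnP _ b0 (@tall Q) (fun a => height (jposet a)) tb0) => a' ta' maxa'.
have jE : jheight Q = height (jposet a').
  apply/eqP; rewrite eqn_leq; apply/andP; split; first exact/bigmax_leqP.
  exact: (leq_bigmax_cond (F := fun a : Q => height (jposet a))).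
have [x ax] := height_gt0_step ta' hQ; have [j jj] := jirr_exists ax.
have [y0 ty0] := tall_exists (exist (jirr _) j jj : jposet a').
have [a ta i] := tall_transfer ta'.
have [C [D [E [K [c [e [iP iQ iY iJ tce]]]]]]] := component_refinement y0 cP ta' i.
have [_ hQa] := tall_base ta'; have [_ hY] := tall_base ty0.
have [h bh eh] := iP; have [k hk kh] := bh.
have [hY' bhY ehY] := iY.
have d0 : D := (h p0).2; have k0 : K := (hY' (base y0)).2.
have hPE : height P = height C + height D by rewrite (height_iso iP) (height_prod c d0).
have hQE : height Q = height C + height E by rewrite -hQa (height_iso iQ) (height_prod c e).
have hYE : jheight Q = height D + height K.
  by rewrite jE -hY (height_iso iY) (height_prod (d0 : dual_poset D) k0) height_dual.
have := tce; rewrite tall_prod => /andP[/= tc te].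
have [d td] := tall_exists d0.
(* Pairing [c] with a tall [d] of [D] yields a tall element of [P]. *)
have jc : height (jposet c) <= jheight P.
  have tcd : tall ((c, d) : C [*] D) by rewrite tall_prod /= tc.
  have tk : tall (k (c, d)) by rewrite -(tall_iso _ bh eh) kh.
  apply: leq_trans (leq_bigmax_cond (F := fun a : P => height (jposet a)) _ tk).
  rewrite (height_iso (jposet_iso _ bh eh)) kh.
  exact: height_jposet_prodl.
suff : height (jposet a') <= maxn (height E).-1 (height (jposet c)).
  by rewrite -jE; lia.
by rewrite -(height_iso iJ); apply: height_jposet_prod.
Qed.

(* Here [Y] is a component of minimal size.  If [E] is nontrivial, then [J a'] has
   a component inside [E] minus [e], so [#|D| <= #|Y| < #|E|] and [#|P| < #|Q|]. *)
Lemma iso_of_card : #|Q| <= #|P| -> 0 < height Q -> connected Q /\ iso P Q.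
Proof.
move=> leQP hQ; have P0 : 0 < #|P| by apply/card_gt0P; exists p0.
have hPQ : height P <= height Q by have := height_card_eq; nia.
have [a' ta'] := tall_exists q0.
have [x ax] := height_gt0_step ta' hQ; have [j jj] := jirr_exists ax.
pose size (y : jposet a') := #|component y|.
have [y0 miny0] : exists y0, forall y, size y0 <= size y.
  by case: (@arg_minnP _ (exist (jirr a') j jj) xpredT size) => // y0 _ h;
     exists y0 => y; apply: h.
have [a ta i] := tall_transfer ta'.
have [C [D [E [K [c [e [iP iQ iY iJ tce]]]]]]] := component_refinement y0 cP ta' i.
have [_ hQa] := tall_base ta'.
have [h bh eh] := iP; have [hY' bhY ehY] := iY.
have d0 : D := (h p0).2; have k0 : K := (hY' (base y0)).2.
have hPE : height P = height C + height D by rewrite (height_iso iP) (height_prod c d0).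
have hQE : height Q = height C + height E by rewrite -hQa (height_iso iQ) (height_prod c e).
have cPE : #|P| = #|C| * #|D| by rewrite (iso_card iP) card_prod_poset.
have cQE : #|component a'| = #|C| * #|E| by rewrite (iso_card iQ) card_prod_poset.
have cQ : #|component a'| <= #|Q| by rewrite card_sig max_card.
have C0 : 0 < #|C| by apply/card_gt0P; exists c.
have K0 : 0 < #|K| by apply/card_gt0P; exists k0.
have cE : connected E.
  exact: connected_prodr c (connected_iso iQ (@component_connected _ a')).
have cD : connected D by apply: connected_prodr c (connected_iso iP cP).
have := tce; rewrite tall_prod => /andP[/= tc te].
have hE : height E = 0.
  apply/eqP; rewrite -leqn0 leqNgt; apply/negP => hE.
  have [v ev] := height_gt0_step te hE; have [u ju] := jirr_exists ev.
  have ju' : jirr ((c, e) : C [*] E) (c, u) by apply/jirr_prodP; left.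
  have lt := card_jcomponent ju' (jirr_gt ju).
  have [g bg eg] := iJ.
  have := miny0 (g (exist (jirr ((c, e) : C [*] E)) _ ju'));
    rewrite /size -(iso_card (component_iso _ bg eg)).
  have -> : #|component y0| = #|D| * #|K| by rewrite (iso_card iY) card_prod_poset.
  by nia.
(* [height P <= height Q], with [height C] in common, gives [height D <= height E = 0]. *)
have E1 := height0_card cE hE; have D1 : #|D| <= 1 by apply: height0_card => //; lia.
have iPQ : iso P (component a').
  apply: iso_trans iP (iso_trans (iso_prod1 _ d0 D1) _).
  by apply: iso_trans (iso_sym (iso_prod1 _ e E1)) (iso_sym iQ).
(* The component of [a'] has as many elements as [P], hence at least as many as [Q]. *)
have full (y : Q) : connect (@pcmp Q) a' y.
  have : #|component a'| == #|Q| by rewrite eqn_leq cQ -(iso_card iPQ).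
  rewrite card_sig => /eqP cc; have /subset_cardP : #|connect (@pcmp Q) a'| = #|Q| by [].
  by move=> /(_ (subset_predT _))/(_ y).
split; last exact: iso_trans iPQ (iso_subT full).
by move=> y z; apply: connect_trans (full z); rewrite connect_pcmp_sym.
Qed.

(** [P] is a single point and has one self-map; hence so does [Q], and its constant maps all
    coincide. *)
Lemma iso_of_height0 : height Q = 0 -> connected Q /\ iso P Q.
Proof.
move=> hQ; have P0 : 0 < #|P| by apply/card_gt0P; exists p0.
have hP : height P = 0 by have := height_card_eq; nia.
have P1 := height0_card cP hP.
have allP (x y : P) : x = y by move/card_le1_eqP: P1; apply.
have [psi pK Kp] := phi_bij.
have allQ (x y : Q) : x = y.
  have [f fE] := const_exists x; have [g gE] := const_exists y.
  have -> : x = ap f x by rewrite fE.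
  by rewrite -(Kp f) (_ : psi f = psi g) ?Kp ?gE //; apply: ap_inj.
split; first by move=> x y; rewrite (allQ x y) connect0.
apply: (@iso_intro _ _ (fun => q0)) => [x y|u]; last by exists p0.
by rewrite (allP x y) !ple_refl.
Qed.

Lemma connected_iso_of_selfmaps : connected Q /\ iso P Q.
Proof.
case: (posnP (height Q)) => [|hQ]; first exact: iso_of_height0.
by apply: iso_of_card; rewrite ?card_selfmap_le.
Qed.
End SelfMapIso.

(** * Transfer to the ordered types of the statement *)

Section OfFinPOrder.
Import Order.Theory.
Definition poset_of (d : Order.disp_t) (T : finPOrderType d) : poset :=
  Poset (@le_refl d T) (@le_anti d T) (@le_trans d T).
End OfFinPOrder.

Theorem theorem10 (d1 d2 : Order.disp_t)
  (P : finPOrderType d1) (Q : finPOrderType d2) :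
  (0 < #|P|)%N -> (0 < #|Q|)%N ->
  connected_poset P ->
  selfmap_posets_iso P Q ->
  connected_poset Q /\ poset_iso P Q.
Proof.
move=> /card_gt0P[p0 _] /card_gt0P[q0 _] cP [phi [bphi ephi]].
have e : @embedding (map_poset (poset_of P)) (map_poset (poset_of Q)) phi.
  by move=> f g; apply/forallP/forallP => h; have := ephi f g; rewrite /pw_le; intuition.
have [cQ [h bh eh]] :=
  @connected_iso_of_selfmaps (poset_of P) (poset_of Q) phi bphi e p0 q0 cP.
split; first exact: cQ.
by exists h; split=> // x y; have /= <- := eh x y.
Qed.
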